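(* Let $X,Y,Z,W$ be locally convex Hausdorff topological vector spaces, $K\subset Y$ a proper closed convex cone with $\operatorname{int}K\ne\emptyset$, $P\subset W$ and $S\subset Z$ nonempty convex cones, $F\colon X\to Y^\infty$, $\kappa\colon W\to Y^\infty$, $H\colon X\to W^\infty$, $G\colon X\to Z^\infty$ proper mappings, $C\subset X$ nonempty, $A=C\cap G^{-1}(-S)$, and assume $A\cap\operatorname{dom}F\cap H^{-1}(\operatorname{dom}\kappa)\neq\emptyset$. Put $$\mathcal M^3=\bigcup_{T_1\in\operatorname{dom}\kappa^*,\; T_2\in\mathcal L_+^w(S,K)}\Psi\big(\mathfrak E\mathrm{pi}F^*\boxplus\mathfrak E\mathrm{pi}(T_1\circ H+T_2\circ G)^*\boxplus\mathfrak E\mathrm{pi}I_C^*\boxplus\{(0_{\mathcal L},\kappa^*(T_1)\uplus I_{-S}^*(T_2))\}\big),$$ $$\mathcal M^3_+=\bigcup_{T_1\in\operatorname{dom}\kappa^*\cap\mathcal L_+(P,K),\; T_2\in\mathcal L_+(S,K)}\Psi\big(\mathfrak E\mathrm{pi}F^*\boxplus\mathfrak E\mathrm{pi}(T_1\circ H+T_2\circ G)^*\boxplus\mathfrak E\mathrm{pi}I_C^*\boxplus\{(0_{\mathcal L},\kappa^*(T_1))\}\big).$$ For $(L,y)\in\mathcal L(X,Y)\times Y$ consider the assertions: $(\alpha')$ if $x\in C$ and $G(x)\in-S$, then $F(x)+(\kappa\circ H)(x)-L(x)+y\notin-\operatorname{int}K$; $(\zeta')$ there exist $L',L''\in\mathcal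 L(X,Y)$, $T_1\in\operatorname{dom}\kappa^*$, $T_2\in\mathcal L_+^w(S,K)$ such that for all $(x,x',x'')\in X\times X\times C$ $$F(x)-L'(x)+(T_1\circ H)(x')+(T_2\circ G)(x')-(L-L'-L'')(x')-L''(x'')+y\notin\kappa^*(T_1)+T_2(-S)-\operatorname{int}K;$$ $(\eta')$ there exist $L',L''\in\mathcal L(X,Y)$, $T_1\in\operatorname{dom}\kappa^*\cap\mathcal L_+(P,K)$, $T_2\in\mathcal L_+(S,K)$ such that for all $(x,x',x'')\in X\times X\times C$ $$F(x)-L'(x)+(T_1\circ H)(x')+(T_2\circ G)(x')-(L-L'-L'')(x')-L''(x'')+y\notin\kappa^*(T_1)-\operatorname{int}K.$$ Then: (1) $\operatorname{epi}(F+\kappa\circ H+I_A)^*=\mathcal M^3$ if and only if $(\alpha')\Leftrightarrow(\zeta')$ for all $(L,y)\in\mathcal L(X,Y)\times Y$; (2) $\operatorname{epi}(F+\kappa\circ H+I_A)^*=\mathcal M^3_+$ if and only if $(\alpha')\Leftrightarrow(\eta')$ for all $(L,y)\in\mathcal L(X,Y)\times Y$.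
   Context: Ordering: $K$ proper means $K\neq Y$. $y_1<_K y_2$ iff $y_1-y_2\in-\operatorname{int}K$. $Y^\infty=Y\cup\{+\infty_Y\}$, $Y^\bullet=Y\cup\{\pm\infty_Y\}$, with $-\infty_Y<_Ky<_K+\infty_Y$ for $y\in Y$, $-\infty_Y<_K+\infty_Y$, $-(\pm\infty_Y)=\mp\infty_Y$, $y+(+\infty_Y)=+\infty_Y$ for $y\in Y^\infty$, $M+\{+\infty_Y\}=\{+\infty_Y\}$ for $M\subset Y$; similarly $W^\infty=W\cup\{+\infty_W\}$, $Z^\infty=Z\cup\{+\infty_Z\}$. For $M\subset Y^\bullet$: $\operatorname{WSup}M$ is the set of $\bar v\in Y^\bullet$ such that $\bar v\not<_Kv$ for all $v\in M$ and for every $\tilde v\in Y^\bullet$ with $\tilde v<_K\bar v$ there is $v\in M$ with $\tilde v<_Kv$. A mapping into $Y^\infty$ (or $W^\infty$, $Z^\infty$) is proper if its domain (set of points where it is not $+\infty$) is nonempty. $\kappa(+\infty_W)=+\infty_Y$. For $T\in\mathcal L(Z,Y)$ (continuous linear maps), $(T\circ G)(x)=T(G(x))$ if $G(x)\in Z$ and $+\infty_Y$ otherwise; likewise $T\circ H$. $I_D(x)=0_Y$ if $x\in D$, $+\infty_Y$ otherwise. $0_{\mathcal L}$ is the zero of $\mathcal L(X,Y)$. $\mathcal L_+(S,K)=\{T\in\mathcal L(Z,Y):T(S)\subset K\}$, $\mathcal L_+^w(S,K)=\{T\in\mathcal L(Z,Y):T(S)\cap(-\operatorname{int}K)=\emptyset\}$,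 and $\mathcal L_+(P,K)$ is defined analogously. Conjugates: for $E\colon X\to Y^\infty$, $E^*(L)=\operatorname{WSup}\{L(x)-E(x):x\in X\}$, $\operatorname{dom}E^*=\{L:E^*(L)\neq\{+\infty_Y\}\}$, $\operatorname{epi}E^*=\{(L,y)\in\mathcal L(X,Y)\times Y:y\in E^*(L)+K\}$; likewise for mappings on $W$, $Z$ ($\kappa^*$, $I_{-S}^*$). Set order: for nonempty $M,N\subset Y^\bullet$, $M\preccurlyeq_KN$ iff $v\not<_Ku$ for all $u\in M$, $v\in N$. $\mathcal P_p(Y)$ is the collection of $U\subset Y$ such that $Y$ is the disjoint union of $U-\operatorname{int}K$, $U$, $U+\operatorname{int}K$; $\mathcal P_p(Y)^\infty=\mathcal P_p(Y)\cup\{\{+\infty_Y\}\}$. For $U,V\in\mathcal P_p(Y)^\infty$, $U\uplus V=\operatorname{WSup}(U+V)$ (a commutative, associative operation). Extended epigraph: $\mathfrak E\mathrm{pi}E^*=\{(L,U)\in\mathcal L(X,Y)\times\mathcal P_p(Y):L\in\operatorname{dom}E^*,\ E^*(L)\preccurlyeq_KU\}$. $\mathscr M\boxplus\mathscr N=\{(L_1+L_2,U_1\uplus U_2):(L_1,U_1)\in\mathscr M,(L_2,U_2)\in\mathscr N\}$. $\Psi(L,U)=\{L\}\times U$ for $U\in\mathcal P_p(Y)$, and $\Psi(\mathscr M)=\bigcup_{(L,U)\in\mathscr M}\Psi(L,U)$; pairs $(L,\{+\infty_Y\})$ that may arise from $\uplus$ contribute the empty set to $\Psi$. *)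

(* Defs.v *)
From HB Require Import structures.
From mathcomp Require Import all_boot all_order all_algebra.
From mathcomp Require Import all_classical all_reals all_analysis.

Set Implicit Arguments.
Unset Strict Implicit.
Unset Printing Implicit Defensive.

Import Order.TTheory GRing.Theory Num.Theory.
Import numFieldNormedType.Exports.

Local Open Scope classical_set_scope.
Local Open Scope ring_scope.

(* Y^\bullet is the type [\bar Y] (it exists over any type) with its addition
   and opposite, and without its order, which is the one of a numeric domain.
   A mapping into Y^\infty is a function f into [\bar Y] with f x <> -oo for
   all x; this is part of [proper_map].  The sum (+oo) + (-oo), which the
   library sets to -oo, is never formed in what follows. *)

Definition proper_map (T V : Type) (f : T -> \bar V) : Prop :=
  (forall x, f x <> -oo%E) /\ (exists x, f x <> +oo%E).

Definition edom (T V : Type) (f : T -> \bar V) : set T :=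
  [set x | f x <> +oo%E].

(* f o g, extended by f(+oo) = +oo. *)
Definition ecomp (T V U : Type) (f : V -> \bar U) (g : T -> \bar V)
    (x : T) : \bar U :=
  match g x with
  | EFin v => f v
  | _ => +oo%E
  end.

(* In all this file -A is [-%R @` A]. *)
Definition esetD (V : nmodType) (A B : set (\bar V)) : set (\bar V) :=
  [set (a + b)%E | a in A & b in B].

Definition convex_cone (R : realType) (V : lmodType R) (A : set V) : Prop :=
  convex_set A /\ (forall (t : R) (v : V), 0 < t -> A v -> A (t *: v)).

(* The set L(X, Y) of continuous linear maps, as a set of functions, so that
   its sum and its zero are those of functions. *)
Definition contlin (R : realType) (X Y : tvsType R) : set (X -> Y) :=
  [set f | linear f /\ continuous f].
Arguments contlin {R} X Y.

Section ordering.
Context (R : realType) (Y : tvsType R) (K : set Y).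
Implicit Types (u v : \bar Y) (M N U V : set (\bar Y)).

Definition ltK u v : Prop :=
  match u, v with
  | EFin y1, EFin y2 => (-%R @` interior K) (y1 - y2)
  | ENInf, EFin _ | ENInf, EPInf | EFin _, EPInf => True
  | _, _ => False
  end.

Definition WSup M : set (\bar Y) :=
  [set v | (forall u, M u -> ~ ltK v u) /\
           (forall w, ltK w v -> exists2 u, M u & ltK w u)].

Definition preceqK M N : Prop := forall u v, M u -> N v -> ~ ltK v u.

(* P_p(Y), its elements being seen as subsets of Y^\bullet. *)
Definition Pp : set (set (\bar Y)) :=
  [set EFin @` U | U in [set U : set Y |
    let Um := [set u - k | u in U & k in interior K] in
    let Up := [set u + k | u in U & k in interior K] in
    [/\ Um `|` U `|` Up = setT,
        Um `&` U = set0, U `&` Up = set0 & Um `&` Up = set0]]].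

Definition uplus U V : set (\bar Y) := WSup (esetD U V).

End ordering.

Section conjugate.
Context (R : realType) (X Y : tvsType R) (K : set Y).
Implicit Types (E : X -> \bar Y) (L : X -> Y).

Definition indic_map (D : set X) : X -> \bar Y :=
  fun x => if x \in D then 0%:E else +oo%E.

Definition conjugate E L : set (\bar Y) :=
  WSup K [set ((L x)%:E - E x)%E | x in setT].

Definition dom_conj E : set (X -> Y) :=
  [set L | contlin X Y L /\ conjugate E L <> [set +oo%E]].

Definition epi_conj E : set ((X -> Y) * Y) :=
  [set Ly | contlin X Y Ly.1 /\
            esetD (conjugate E Ly.1) (EFin @` K) Ly.2%:E].

Definition Epi_conj E : set ((X -> Y) * set (\bar Y)) :=
  [set LU | [/\ dom_conj E LU.1, Pp K LU.2 &
                preceqK K (conjugate E LU.1) LU.2]].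

Definition boxplus (M N : set ((X -> Y) * set (\bar Y))) :
    set ((X -> Y) * set (\bar Y)) :=
  [set (p.1 + q.1, uplus K p.2 q.2) | p in M & q in N].

(* {L} x (U `&` Y): this is {L} x U when U is in P_p(Y), and it is empty when
   U = {+oo}. *)
Definition Psi1 (p : (X -> Y) * set (\bar Y)) : set ((X -> Y) * Y) :=
  [set Ly | Ly.1 = p.1 /\ p.2 Ly.2%:E].

Definition Psi (M : set ((X -> Y) * set (\bar Y))) : set ((X -> Y) * Y) :=
  \bigcup_(p in M) Psi1 p.

Definition Lplus (S : set X) : set (X -> Y) :=
  [set T | contlin X Y T /\ T @` S `<=` K].

Definition Lplusw (S : set X) : set (X -> Y) :=
  [set T | contlin X Y T /\ T @` S `&` (-%R @` interior K) = set0].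

End conjugate.

Arguments indic_map {R X} Y D x.

Section composite_problem.
Context (R : realType) (X Y Z W : tvsType R).
Context (K : set Y) (P : set W) (S : set Z) (C : set X).
Context (F : X -> \bar Y) (kappa : W -> \bar Y).
Context (H : X -> \bar W) (G : X -> \bar Z).

Local Notation "U \uplus V" := (uplus K U V) (at level 50, left associativity).
Local Notation "M \boxplus N" := (boxplus K M N)
  (at level 50, left associativity).

Definition feasible : set X := C `&` G @^-1` (EFin @` (-%R @` S)).

Definition objective : X -> \bar Y :=
  fun x => (F x + ecomp kappa H x + indic_map Y feasible x)%E.

Definition scalarized (T1 : W -> Y) (T2 : Z -> Y) : X -> \bar Y :=
  fun x => (ecomp (EFin \o T1) H x + ecomp (EFin \o T2) G x)%E.

Definition M3 : set ((X -> Y) * Y) :=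
  \bigcup_(T1 in dom_conj K kappa) \bigcup_(T2 in Lplusw K S)
    Psi (Epi_conj K F \boxplus Epi_conj K (scalarized T1 T2)
           \boxplus Epi_conj K (indic_map Y C)
           \boxplus [set (0, conjugate K kappa T1
                              \uplus conjugate K (indic_map Y (-%R @` S)) T2)]).

Definition M3plus : set ((X -> Y) * Y) :=
  \bigcup_(T1 in dom_conj K kappa `&` Lplus K P) \bigcup_(T2 in Lplus K S)
    Psi (Epi_conj K F \boxplus Epi_conj K (scalarized T1 T2)
           \boxplus Epi_conj K (indic_map Y C)
           \boxplus [set (0, conjugate K kappa T1)]).

Definition alpha_assertion (L : X -> Y) (y : Y) : Prop :=
  forall x : X, C x -> (EFin @` (-%R @` S)) (G x) ->
    ~ (EFin @` (-%R @` interior K))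
        (F x + ecomp kappa H x - (L x)%:E + y%:E)%E.

Definition zeta_assertion (L : X -> Y) (y : Y) : Prop :=
  exists (L' L'' : X -> Y) (T1 : W -> Y) (T2 : Z -> Y),
    [/\ contlin X Y L', contlin X Y L'', dom_conj K kappa T1, Lplusw K S T2 &
     forall x x' x'' : X, C x'' ->
       ~ esetD (esetD (conjugate K kappa T1) (EFin @` (T2 @` (-%R @` S))))
               (EFin @` (-%R @` interior K))
           (F x - (L' x)%:E + ecomp (EFin \o T1) H x' + ecomp (EFin \o T2) G x'
              - ((L - L' - L'') x')%:E - (L'' x'')%:E + y%:E)%E].

Definition eta_assertion (L : X -> Y) (y : Y) : Prop :=
  exists (L' L'' : X -> Y) (T1 : W -> Y) (T2 : Z -> Y),
    [/\ contlin X Y L', contlin X Y L'',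
        (dom_conj K kappa `&` Lplus K P) T1, Lplus K S T2 &
     forall x x' x'' : X, C x'' ->
       ~ esetD (conjugate K kappa T1) (EFin @` (-%R @` interior K))
           (F x - (L' x)%:E + ecomp (EFin \o T1) H x' + ecomp (EFin \o T2) G x'
              - ((L - L' - L'') x')%:E - (L'' x'')%:E + y%:E)%E].

End composite_problem.

(* Main.v *)
(* For M in Y^bullet let D(M) be the set of the y in Y with y <_K u for some u
   in M.  Then D(WSup M) = D(M), the lower set of a sum is the sum of the lower
   sets, and the finite part of WSup M is the boundary of D(M) in the direction
   of int K.  Hence (L, y) is in epi E^* iff y is not in D(L - E), which for the
   objective is (alpha').  Likewise (zeta') and (eta') say that y is not in the
   sum of the lower sets of the conjugates involved, and membership in M^3 says
   that y is on the boundary of such a sum after the lower sets have been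
   enlarged; translating one of them along int K shows that the two agree.
   So both equalities of sets are equivalences between assertions, for each
   continuous linear L and each y. *)

Require Import Defs.
From mathcomp Require Import all_boot all_order all_algebra.
From mathcomp Require Import all_classical all_reals all_analysis.
From mathcomp Require Import lra.

Import Order.TTheory GRing.Theory Num.Theory.
Import numFieldNormedType.Exports.

Local Open Scope classical_set_scope.
Local Open Scope ring_scope.

Set Implicit Arguments.
Unset Strict Implicit.
Unset Printing Implicit Defensive.

(** * Neighbourhoods along a line *)

Section tvs.
Context {R : realType} {V : tvsType R}.

(** Continuity of addition and of scaling at the scalar [0]. *)
Lemma nbhs_line (A : set V) (x z : V) : nbhs x A ->
  exists2 e : R, 0 < e & A (x + e *: z).
Proof.
move=> Ax.
rewrite -[x]addr0 -(scale0r z) in Ax.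
have [[B1 B2] [/= /nbhs_singleton B1x nB2] sBA] :=
  add_continuous (x, 0 *: z) A Ax.
have [[B3 B4] [/= nB3 /nbhs_singleton B4z] sBB2] :=
  scale_continuous ((0 : R^o), z) B2 nB2.
have /nbhs_ballP[e /= e0 he] := nB3.
(* Half of [e], the ball of radius [e] being open. *)
exists (e / 2); first by rewrite divr_gt0.
apply: (sBA (x, _)); split => //; apply: (sBB2 (_, z)); split => //=.
apply: he; rewrite /ball /= sub0r normrN gtr0_norm ?divr_gt0//.
by rewrite ltr_pdivrMr// ltr_pMr// ltr1n.
Qed.

End tvs.

(** * The cone [K] and its interior *)

Section ordering.
Context (R : realType) (Y : tvsType R) (K : set Y).
Hypotheses (Kcone : convex_cone K) (Kclosed : closed K).
Hypothesis Kint : interior K !=set0.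

Local Notation I := (interior K).

(** The midpoint is in [K] by convexity, and the sum is twice the midpoint. *)
Lemma coneD a b : K a -> K b -> K (a + b).
Proof.
case: Kcone => cK sK Ka Kb.
have h0 : 0 <= 2^-1 :> R by lra.
have h1 : 2^-1 <= 1 :> R by lra.
have := cK a b (Itv01 h0 h1) (mem_set Ka) (mem_set Kb).
move=> /set_mem /(sK 2 _ (ltr0Sn _ _)).
rewrite /conv /= /unstable.onem scalerDr !scalerA.
have -> : 1 - 2^-1 = 2^-1 :> R by lra.
by rewrite mulfV ?pnatr_eq0// !scale1r.
Qed.

Lemma coneZ (t : R) a : 0 < t -> K a -> K (t *: a).
Proof. by case: Kcone => _; exact. Qed.

(** Only positive multiples are given to stay in [K], so [0] is reached as a limit of small
    multiples of some [k]. *)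
Lemma cone0 : K 0.
Proof.
apply: Kclosed => B B0; have [k /interior_subset Kk] := Kint.
have [e e0 Be] := nbhs_line k B0.
by exists (e *: k); split; [exact: coneZ|rewrite add0r in Be].
Qed.

(** For [x] near [a + b], the point [x - b] is near [a], hence in [K]; adding [b] back stays in
    [K]. *)
Lemma intD a b : I a -> K b -> I (a + b).
Proof.
move=> Ia Kb; have := @sub_continuous Y (a + b, b) K.
rewrite /= addrK => /(_ Ia)[[B1 B2] [/= nB1 /nbhs_singleton B2b] sB].
apply: filterS nB1 => x B1x; rewrite -[x](subrK b).
by apply: coneD => //; exact: (sB (x, b)).
Qed.

Lemma intDint a b : I a -> I b -> I (a + b).
Proof. by move=> Ia /interior_subset; exact: intD. Qed.

Lemma intZ (t : R) a : 0 < t -> I a -> I (t *: a).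
Proof.
move=> t0 Ia; have := @scale_continuous R Y ((t^-1 : R^o), t *: a) K.
rewrite /= scalerA mulVf ?gt_eqF// scale1r.
move=> /(_ Ia)[[B1 B2] [/= /nbhs_singleton B1t nB2] sB].
apply: filterS nB2 => x B2x.
rewrite -[x]scale1r -(mulfV (lt0r_neq0 t0)) -scalerA.
by apply: coneZ => //; exact: (sB (t^-1, x)).
Qed.

Lemma int_line k z : I k -> exists2 e : R, 0 < e & I (k + e *: z).
Proof.
move=> Ik; apply: nbhs_line.
by apply: open_nbhs_nbhs; split => //; exact: open_interior.
Qed.

(** A small step [k + e *: z] stays in the interior; rescale it by [e^-1]. *)
Lemma int_absorb k z : I k -> exists2 t : R, 0 < t & I (t *: k + z).
Proof.
move=> /(int_line z)[e e0 Ie]; exists e^-1; first by rewrite invr_gt0.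
rewrite -[z in _ + z]scale1r -(mulVf (lt0r_neq0 e0)) -scalerA -scalerDr.
by apply: intZ; rewrite ?invr_gt0.
Qed.

(** * Lower sets and the weak supremum *)

Lemma ltK_fin (x y : Y) : ltK K x%:E y%:E <-> I (y - x).
Proof.
rewrite /ltK; split=> [[k Ik kE]|Iyx]; first by rewrite -opprB -kE opprK.
by exists (y - x); rewrite ?opprB.
Qed.

(* WSup M depends only on the lower set of M, which behaves additively even in
   the presence of infinite elements. *)
Definition lower (M : set (\bar Y)) : set Y :=
  [set w | exists2 u, M u & ltK K w%:E u].

Lemma lower_down M w k : lower M w -> K k -> lower M (w - k).
Proof.
move=> [[u||] Mu wu] Kk; [exists u%:E => //|by exists +oo%E|by []].
move/ltK_fin: wu => wu; apply/ltK_fin; rewrite opprB addrCA addrC.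
exact: intD.
Qed.

Lemma lower_open M w k : lower M w ->
  exists2 e : R, 0 < e & lower M (w + e *: k).
Proof.
move=> [[u||] Mu wu]; [|by exists 1 => //; exists +oo%E|by []].
move/ltK_fin: wu => /(int_line (- k))[e e0 he].
exists e => //; exists u%:E => //.
by apply/ltK_fin; rewrite opprD addrA -scalerN.
Qed.

Lemma WSup_fin M (v : Y) :
  WSup K M v%:E <-> ~ lower M v /\ (forall k, I k -> lower M (v - k)).
Proof.
split=> [[nv hv]|[nv hv]].
  split=> [[u Mu /(nv _ Mu)]//|k Ik].
  by apply: hv; apply/ltK_fin; rewrite opprB addrC subrK.
split=> [u Mu vu|[w||]//]; first by apply: nv; exists u.
  move=> /ltK_fin /hv; rewrite opprB addrC subrK => -[u Mu wu].
  by exists u.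
(* For [w = -oo] any element of [M] other than [-oo] will do, and [lower M] is nonempty. *)
by have [k /hv[[u||] Mu //]] := Kint; [exists u%:E|exists +oo%E].
Qed.

Lemma WSup_pinfty M : WSup K M = [set +oo%E] <-> lower M = setT.
Proof.
split=> [ME|ME].
  apply/seteqP; split=> // w _.
  have : WSup K M +oo%E by rewrite ME.
  by case=> _ /(_ w%:E Logic.I).
have lM w : lower M w by rewrite ME.
apply/seteqP; split=> [[v||]|_ ->]//=.
- by move=> /WSup_fin[/(_ (lM _))].
- move=> [nM _]; have [[u||] Mu //] := lM 0; case: (nM _ Mu) => //.
- split=> [[u||] _ []|[w||]// _]; first exact: lM.
  by have [[u||] Mu //] := lM 0; [exists u%:E|exists +oo%E].
Qed.

(** On the line through [p] in the direction [k], the parameters of points of [lower M] form a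
    down-closed set, nonempty and bounded because [int K] absorbs; its supremum gives the boundary
    point. *)
Lemma WSup_line M k p : I k -> lower M !=set0 -> lower M <> setT ->
  exists s : R, WSup K M (p + s *: k)%:E.
Proof.
move=> Ik [w0 Mw0] MT.
have [y My] : exists y, ~ lower M y.
  by apply: contrapT => /forallNP h; apply: MT; apply/seteqP; split=> // w _;
    apply: contrapT; exact: h.
pose A := [set s : R | lower M (p + s *: k)].
have Kk := interior_subset Ik.
have Adown s t : t <= s -> A s -> A t.
  rewrite le_eqVlt => /predU1P[->//|ts] As; rewrite /A /=.
  have -> : p + t *: k = p + s *: k - (s - t) *: k.
    by rewrite scalerBl opprB addrACA subrr addr0.
  by apply: lower_down => //; apply: coneZ; rewrite ?subr_gt0.
have A0 : A !=set0.
  have [t t0 It] := int_absorb (w0 - p) Ik; exists (- t).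
  rewrite /A /=; have -> : p + - t *: k = w0 - (t *: k + (w0 - p)).
    by rewrite scaleNr opprD opprB addrCA (addrC w0) subrK addrC.
  by apply: lower_down => //; exact: interior_subset.
have ubA : has_ubound A.
  (* [t] is so large that [p + t *: k] lies above [y], which is outside [lower M]. *)
  have [t t0 It] := int_absorb (p - y) Ik; exists t => s As.
  rewrite leNgt; apply/negP => ts; apply: My.
  have -> : y = p + t *: k - (t *: k + (p - y)).
    by rewrite opprD opprB addrA addrK addrCA subrr addr0.
  by apply: lower_down; [exact: (Adown s t (ltW ts))|exact: interior_subset].
have sA : has_sup A by split.
(* The supremum is not attained, since [lower M] is open along [k]. *)
have nA : ~ A (sup A).
  move=> /(lower_open k)[e e0]; rewrite -addrA -scalerDl => As.
  have := ub_le_sup ubA As.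
  by rewrite gerDl leNgt e0.
exists (sup A); apply/WSup_fin; split=> // j Ij.
(* With [j - e *: k] still interior, the point to reach lies below [p + (sup A - e) *: k], which is
   in [lower M]. *)
have [e e0 Ie] := int_line (- k) Ij.
have [s As ss] := sup_adherent e0 sA.
have -> : p + sup A *: k - j = p + (sup A - e) *: k - (j + e *: - k).
  by rewrite scalerBl scalerN addrA opprD opprK (addrC (- j)) addrA subrK.
apply: lower_down; last exact: interior_subset.
exact: (Adown s _ (ltW ss)).
Qed.

(** The parameter given by [WSup_line] cannot be positive: [y] would be strictly below a boundary
    point, hence in [lower M]. *)
Lemma WSup_below M k y : I k -> lower M !=set0 -> ~ lower M y ->
  exists2 s : R, 0 <= s & WSup K M (y - s *: k)%:E.
Proof.
move=> Ik M0 My.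
have [|s Ms] := WSup_line y Ik M0; first by move=> MT; apply: My; rewrite MT.
exists (- s); last by rewrite scaleNr opprK.
rewrite oppr_ge0 leNgt; apply/negP => s0; apply: My.
have /WSup_fin[_ /(_ _ (intZ s0 Ik))] := Ms.
by rewrite addrK.
Qed.

(** Here the parameter must be positive, or the boundary point would itself lie in [lower M]. *)
Lemma WSup_above M w : lower M w -> lower M <> setT ->
  exists2 k, I k & WSup K M (w + k)%:E.
Proof.
move=> Mw MT; have [k Ik] := Kint.
have [|s Ms] := WSup_line w Ik _ MT; first by exists w.
exists (s *: k) => //; apply: intZ => //; rewrite ltNge; apply/negP => s0.
have /WSup_fin[+ _] := Ms; apply.
rewrite -[s]opprK scaleNr.
move: s0; rewrite -oppr_ge0 le_eqVlt => /predU1P[<-|s0].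
  by rewrite scale0r subr0.
by apply: lower_down => //; apply: coneZ => //; exact: interior_subset.
Qed.

(** A point of [lower M] is below a boundary point, or below [+oo] when [lower M] is everything. *)
Lemma lower_WSup M : lower (WSup K M) = lower M.
Proof.
apply/seteqP; split=> w; first by move=> [v [_ hv] /hv].
move=> Mw; have [MT|MT] := pselect (lower M = setT).
  by exists +oo%E => //; rewrite (WSup_pinfty M).2.
have [k Ik Mk] := WSup_above Mw MT.
by exists (w + k)%:E => //; apply/ltK_fin; rewrite addrC addKr.
Qed.

Lemma WSup_image M : lower M !=set0 -> lower M <> setT ->
  WSup K M = EFin @` [set v | WSup K M v%:E].
Proof.
move=> [w [u Mu wu]] MT; apply/seteqP; split=> [[v||] Mv|_ [v Mv <-]//].
- by exists v.
- exfalso; apply: MT; apply/seteqP; split=> // z _.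
  by rewrite -lower_WSup; exists +oo%E.
- case: Mv => /(_ u Mu) nu _.
  by case: u wu nu {Mu} => [?||] // _ []; exact: Logic.I.
Qed.

(** The piece [U - int K] is [lower M]. A point outside it descends along [k0] to the boundary, and
    is in [U] or in [U + int K] according as the step is zero or positive. *)
Lemma Pp_WSup M : lower M !=set0 -> lower M <> setT -> Pp K (WSup K M).
Proof.
move=> M0 MT; exists [set v | WSup K M v%:E]; last by rewrite -WSup_image.
have lowerP z : [set u - k | u in [set v | WSup K M v%:E] & k in I] z ->
    lower M z.
  by move=> [u /WSup_fin[_ hu] [k Ik <-]]; exact: hu.
have upperP z : [set u + k | u in [set v | WSup K M v%:E] & k in I] z ->
    ~ lower M z.
  move=> [u /WSup_fin[nu _] [k /interior_subset Kk <-]] /lower_down/(_ Kk).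
  by rewrite addrK.
have [k0 Ik0] := Kint.
split; apply/seteqP; split=> // z.
- move=> _; have [Mz|Mz] := pselect (lower M z).
    left; left; have [k Ik Mk] := WSup_above Mz MT.
    by exists (z + k) => //; exists k => //; rewrite addrK.
  have [s + Ms] := WSup_below Ik0 M0 Mz.
  rewrite le_eqVlt => /predU1P[s0|s0].
    by left; right; move: Ms; rewrite -s0 scale0r subr0.
  right; exists (z - s *: k0) => //; exists (s *: k0); first exact: intZ.
  by rewrite subrK.
- by move=> [/lowerP Mz /WSup_fin[]].
- move=> [/WSup_fin[_ Mz] [u /WSup_fin[nu _] [k Ik uk]]]; apply: nu.
  by have := Mz _ Ik; rewrite -uk addrK.
- by move=> [/lowerP Mz /upperP].
Qed.

(** Of the three pieces given by [U], a point of [lower M] can only be in the lowest: otherwise some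
    element of [U] would be in [lower M]. *)
Lemma Pp_lower_sub M U : Pp K U -> preceqK K M U -> lower M `<=` lower U.
Proof.
move=> [V [VT _ _ _] <-] MV w Mw.
have nMV v : V v -> ~ lower M v.
  by move=> Vv [u Mu]; apply: (MV u) => //; exists v.
have : setT w by [].
rewrite -VT => -[[[v Vv [k Ik <-]]|/nMV//]|[v Vv [k Ik vk]]].
  by exists v%:E; [exists v|apply/ltK_fin; rewrite opprB addrC subrK].
exfalso; apply: (nMV _ Vv).
have -> : v = w - k by rewrite -vk addrK.
by apply: lower_down => //; exact: interior_subset.
Qed.

(** * Lower sets of sums and translates *)

Lemma lower_esetD A B w : lower (esetD A B) w <->
  exists a b, [/\ lower A a, lower B b & w = a + b].
Proof.
have [k0 Ik0] := Kint.
have ltB (x k : Y) : I k -> ltK K (x - k)%:E x%:E.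
  by move=> Ik; apply/ltK_fin; rewrite opprB addrC subrK.
split=> [[_ [u Au [v Bv <-]]]|[a [b [[u Au au] [v Bv bv] ->]]]]; last first.
  exists (u + v)%E; first by exists u => //; exists v.
  case: u v au bv {Au Bv} => [u||] [v||] // /ltK_fin au /ltK_fin bv.
  by apply/ltK_fin; rewrite opprD addrACA; exact: intDint.
case: u v Au Bv => [u||] [v||] Au Bv // wuv.
(* The gap between [w] and [u + v] is shared equally by the two terms. *)
- move/ltK_fin: wuv => wuv; pose k := 2^-1 *: (u + v - w).
  have Ik : I k by apply: intZ; rewrite ?invr_gt0.
  exists (u - k), (v - k); split; [by exists u%:E; last exact: ltB|
    by exists v%:E; last exact: ltB|].
  rewrite addrACA -opprD /k -scalerDl -div1r -splitr scale1r.
  by rewrite opprB addrC subrK.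
(* The finite term is lowered by [k0], and the infinite one takes whatever remains. *)
- exists (u - k0), (w - (u - k0)); split.
  + by exists u%:E; last exact: ltB.
  + by exists +oo%E.
  + by rewrite addrCA subrr addr0.
- exists (w - (v - k0)), (v - k0); split.
  + by exists +oo%E.
  + by exists v%:E; last exact: ltB.
  + by rewrite subrK.
- by exists 0, w; rewrite add0r; split=> //; exists +oo%E.
Qed.

Lemma lower_esetD_neq0 A B :
  lower A !=set0 -> lower B !=set0 -> lower (esetD A B) !=set0.
Proof.
by move=> [a Aa] [b Bb]; exists (a + b); apply/lower_esetD; exists a, b.
Qed.

Lemma lower_esetDS A A' B B' : lower A `<=` lower A' -> lower B `<=` lower B' ->
  lower (esetD A B) `<=` lower (esetD A' B').
Proof.
move=> AA' BB' w /lower_esetD[a [b [/AA' Aa /BB' Bb wab]]].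
by apply/lower_esetD; exists a, b.
Qed.

Lemma eq_lower_esetD A A' B B' : lower A = lower A' -> lower B = lower B' ->
  lower (esetD A B) = lower (esetD A' B').
Proof.
by move=> AA' BB'; apply/seteqP; split; apply: lower_esetDS; rewrite ?AA' ?BB'.
Qed.

Lemma lower_esetD_neqT A B : lower A !=set0 -> lower B !=set0 ->
  lower (esetD A B) <> setT -> lower A <> setT /\ lower B <> setT.
Proof.
move=> [a Aa] [b Bb] ABT; split=> T; apply: ABT; apply/seteqP; split=> // w _;
  apply/lower_esetD.
- by exists (w - b), b; rewrite T subrK.
- by exists a, (w - a); rewrite T addrCA subrr addr0.
Qed.

(** All the lowering can be charged to [B] once the elements of [A] that matter are finite. *)
Lemma lower_esetD_fin A B w : ~ A +oo%E ->
  lower (esetD A B) w <-> exists2 a, A a%:E & lower B (w - a).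
Proof.
move=> Aoo; split=> [[_ [[a||] Aa [b Bb <-]] wab]|[a Aa [b Bb wab]]].
- exists a => //; exists b => //; case: b wab {Bb} => // b /ltK_fin wab.
  by apply/ltK_fin; rewrite opprB addrA [b + a]addrC.
- by [].
- by case: b wab {Bb}.
- exists (a%:E + b)%E; first by exists a%:E => //; exists b.
  case: b wab {Bb} => // b /ltK_fin wab; apply/ltK_fin.
  by move: wab; rewrite opprB addrA [b + a]addrC.
Qed.

Definition shift (c : Y) (M : set (\bar Y)) := esetD M [set c%:E].

Lemma lower_shift c M w : lower (shift c M) w <-> lower M (w - c).
Proof.
split=> [[_ [u Mu [_ -> <-]] wu]|[u Mu wu]].
  exists u => //; case: u wu {Mu} => // u /ltK_fin wu.
  by apply/ltK_fin; rewrite opprB addrA.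
exists (u + c%:E)%E; first by exists u => //; exists c%:E.
case: u wu {Mu} => // u /ltK_fin wu.
by apply/ltK_fin; move: wu; rewrite opprB addrA.
Qed.

Lemma lower_shift_esetD c A A' B : (forall w, lower A' w <-> lower A (w - c)) ->
  forall w, lower (esetD A' B) w <-> lower (esetD A B) (w - c).
Proof.
move=> AA' w; split=> /lower_esetD[a [b [Aa Bb wab]]]; apply/lower_esetD.
  by exists (a - c), b; split=> //; [exact/AA'|rewrite wab addrAC].
exists (a + c), b; split=> //; first by apply/AA'; rewrite addrK.
by rewrite addrAC -wab subrK.
Qed.

(** * Conjugates and their epigraphs *)

Definition dual_values (X : Type) (E : X -> \bar Y) (L : X -> Y) :
    set (\bar Y) :=
  [set ((L x)%:E - E x)%E | x in setT].

Section conjugate.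
Context (X : tvsType R).
Implicit Types (E : X -> \bar Y) (L : X -> Y).

Lemma contlinD L1 L2 :
  contlin X Y L1 -> contlin X Y L2 -> contlin X Y (L1 + L2).
Proof.
move=> [l1 c1] [l2 c2]; split=> [a u v|x].
  by rewrite !fctE l1 l2 scalerDr addrACA.
apply: (@continuous_comp _ _ _ (fun x => (L1 x, L2 x))
  (fun p : Y * Y => p.1 + p.2)).
  by apply: cvg_pair; [exact: c1|exact: c2].
exact: add_continuous.
Qed.

Lemma contlinB L1 L2 :
  contlin X Y L1 -> contlin X Y L2 -> contlin X Y (L1 - L2).
Proof.
move=> c1 [l2 c2]; apply: contlinD => //; split=> [a u v|x].
  by rewrite !fctE l2 opprD scalerN.
by apply: continuous_comp; [exact: c2|exact: opp_continuous].
Qed.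

Lemma dual_values_npinfty E L :
  (forall x, E x <> -oo%E) -> ~ dual_values E L +oo%E.
Proof. by move=> Eoo [x _]; case: (E x) (Eoo x). Qed.

Lemma lower_dual_values_neq0 E L :
  proper_map E -> lower (dual_values E L) !=set0.
Proof.
move=> [Eoo [x Ex]]; have [k Ik] := Kint.
case Exe : (E x) => [e||] //; last by have := Eoo x.
exists (L x - e - k), (L x - e)%:E; first by exists x; rewrite ?Exe.
by apply/ltK_fin; rewrite opprB addrC subrK.
Qed.

Lemma dom_conj_lower E L : dom_conj K E L <->
  contlin X Y L /\ lower (dual_values E L) <> setT.
Proof.
by split=> -[cL h]; split=> //; move: h; apply: contra_not => /WSup_pinfty.
Qed.

(** A point outside the lower set descends to its boundary along a direction of [int K]. The step
    may be zero, hence the use of [cone0]. *)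
Lemma epi_conjP E L y : proper_map E ->
  epi_conj K E (L, y) <-> contlin X Y L /\ ~ lower (dual_values E L) y.
Proof.
move=> Eprop; split=> [[/= cL [v Mv [_ [k Kk <-]]]]|[cL Ly]].
  case: v Mv => // v /WSup_fin[nv _] [vy]; split=> //.
  by rewrite -vy => /lower_down/(_ Kk); rewrite addrK.
split=> //=; have [k Ik] := Kint.
have [s s0 Ms] := WSup_below Ik (lower_dual_values_neq0 L Eprop) Ly.
exists (y - s *: k)%:E => //; exists (s *: k)%:E.
  exists (s *: k) => //; move: s0; rewrite le_eqVlt => /predU1P[<-|s0].
    by rewrite scale0r; exact: cone0.
  by apply: coneZ => //; exact: interior_subset.
exact: (congr1 EFin (subrK _ _)).
Qed.

(* Enlarging an element of an extended epigraph translates its lower set, so y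
   can be brought to the boundary of the total lower set by translating only
   the first of the four summands. *)
Lemma Psi_boxplusP E1 E2 E3 (Q : set (\bar Y)) L y :
  proper_map E1 -> proper_map E2 -> proper_map E3 -> lower Q !=set0 ->
  Psi (boxplus K (boxplus K (boxplus K (Epi_conj K E1) (Epi_conj K E2))
         (Epi_conj K E3)) [set (0, Q)]) (L, y) <->
  exists L1 L2 L3, [/\ contlin X Y L1, contlin X Y L2, contlin X Y L3,
    L = L1 + L2 + L3 &
    ~ lower (esetD (esetD (esetD (dual_values E1 L1) (dual_values E2 L2))
               (dual_values E3 L3)) Q) y].
Proof.
move=> E1p E2p E3p Q0; split.
  move=> [_ [_ [_ [[L1 U1] [/dom_conj_lower[cL1 _] PU1 EU1]] [[L2 U2]
    [/dom_conj_lower[cL2 _] PU2 EU2]] <-] [[L3 U3]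
    [/dom_conj_lower[cL3 _] PU3 EU3]] <-] [_ -> <-]] [/= -> /WSup_fin[nyU _]].
  exists L1, L2, L3; split=> //; first by rewrite addr0.
  (* Each [U] dominates its conjugate, so passing to the [U] only enlarges the total lower set. *)
  apply: contra_not nyU; apply: lower_esetDS => //.
  rewrite lower_WSup; apply: lower_esetDS; last first.
    by rewrite -(lower_WSup (dual_values _ _)); exact: Pp_lower_sub.
  rewrite lower_WSup; apply: lower_esetDS.
    by rewrite -(lower_WSup (dual_values _ _)); exact: Pp_lower_sub.
  by rewrite -(lower_WSup (dual_values _ _)); exact: Pp_lower_sub.
move=> [L1 [L2 [L3 [cL1 cL2 cL3 -> ny]]]].
set V1 := dual_values E1 L1 in ny *; set V2 := dual_values E2 L2 in ny *.
set V3 := dual_values E3 L3 in ny *; set T := esetD _ Q in ny *.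
have V10 : lower V1 !=set0 by exact: lower_dual_values_neq0.
have V20 : lower V2 !=set0 by exact: lower_dual_values_neq0.
have V30 : lower V3 !=set0 by exact: lower_dual_values_neq0.
have V120 := lower_esetD_neq0 V10 V20.
have V1230 := lower_esetD_neq0 V120 V30.
have T0 := lower_esetD_neq0 V1230 Q0.
(* As the total lower set omits [y], no summand has a full lower set, so each map lies in the domain
   of its conjugate. *)
have TT : lower T <> setT by move=> TT; apply: ny; rewrite TT.
have [V123T _] := lower_esetD_neqT V1230 Q0 TT.
have [V12T V3T] := lower_esetD_neqT V120 V30 V123T.
have [V1T V2T] := lower_esetD_neqT V10 V20 V12T.
have EpiP E L' : contlin X Y L' -> lower (dual_values E L') !=set0 ->
    lower (dual_values E L') <> setT -> Epi_conj K E (L', conjugate K E L').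
  move=> cL' V0 VT; split=> /=; first exact/dom_conj_lower.
    exact: Pp_WSup.
  by move=> u v [_ hu] [nv _] /hu[u' Vu']; exact: nv.
have [k Ik] := Kint.
(* [y - s *: k] is on the boundary of [lower T]; translating the first summand by [s *: k] brings
   the boundary up to [y]. *)
have [s s0 /WSup_fin[nTs Ts]] := WSup_below Ik T0 ny.
pose U1 := WSup K (shift (s *: k) V1).
have U1E w : lower U1 w <-> lower V1 (w - s *: k).
  by rewrite /U1 lower_WSup; exact: lower_shift.
have PU1 : Epi_conj K E1 (L1, U1).
  have S0 : lower (shift (s *: k) V1) !=set0.
    have [w V1w] := V10; exists (w + s *: k).
    by apply/lower_shift; rewrite addrK.
  have ST : lower (shift (s *: k) V1) <> setT.
    move=> ST; apply: V1T; apply/seteqP; split=> // w _.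
    by rewrite -[w](addrK (s *: k)); apply/lower_shift; rewrite ST.
  split=> /=; [exact/dom_conj_lower|exact: Pp_WSup|move=> u v V1u].
  rewrite /U1 WSup_image// => -[{}v /WSup_fin[nv _] <-] vu.
  (* An element of [U1] below one of the conjugate would be in [lower V1], and so would its
     translate by [- s *: k], as [0 <= s]. *)
  apply/nv/lower_shift.
  have V1v : lower V1 v by rewrite -lower_WSup; exists u.
  move: s0; rewrite le_eqVlt => /predU1P[<-|s0]; first by rewrite scale0r subr0.
  by apply: lower_down => //; apply: coneZ => //; exact: interior_subset.
pose U12 := uplus K U1 (conjugate K E2 L2).
pose U123 := uplus K U12 (conjugate K E3 L3).
exists ((L1 + L2 + L3) + 0, uplus K U123 Q).
  exists (L1 + L2 + L3, U123); last by exists (0, Q).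
  exists (L1 + L2, U12).
    by exists (L1, U1) => //; exists (L2, conjugate K E2 L2) => //; exact: EpiP.
  by exists (L3, conjugate K E3 L3) => //; exact: EpiP.
split=> /=; first by rewrite addr0.
(* The translation passes through the three nested sums. *)
have shiftE w : lower (esetD U123 Q) w <-> lower T (w - s *: k).
  apply: lower_shift_esetD => {}w; rewrite lower_WSup.
  rewrite (eq_lower_esetD (erefl _) (lower_WSup V3)).
  apply: lower_shift_esetD => {}w; rewrite lower_WSup.
  rewrite (eq_lower_esetD (erefl _) (lower_WSup V2)).
  exact: lower_shift_esetD.
apply/WSup_fin; split=> [/shiftE//|j Ij].
by apply/shiftE; rewrite addrAC; exact: Ts.
Qed.

End conjugate.

(** * Finite elements of sums and of sets of dual values *)

Lemma esetD_npinfty (A B : set (\bar Y)) :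
  ~ A +oo%E -> ~ B +oo%E -> ~ esetD A B +oo%E.
Proof. by move=> Aoo Boo [[a||] Aa [[b||] Bb ?]]. Qed.

Lemma esetD_finP (A B : set (\bar Y)) c : esetD A B c%:E <->
  exists a b, [/\ A a%:E, B b%:E & c = a + b].
Proof.
split=> [[[a||] Aa [[b||] Bb]] //= [<-]|[a [b [Aa Bb ->]]]].
  by exists a, b.
by exists a%:E => //; exists b%:E.
Qed.

Lemma dual_values_finP (X : Type) (E : X -> \bar Y) (L : X -> Y) c :
  dual_values E L c%:E <-> exists x e, E x = e%:E /\ c = L x - e.
Proof.
split=> [[x _]|[x [e [Exe ->]]]]; last by exists x; rewrite ?Exe.
by case Exe : (E x) => [e||] //= [<-]; exists x, e.
Qed.

(** * The assertions in terms of lower sets *)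

Section composite.
Context (X Z W : tvsType R) (P : set W) (S : set Z) (C : set X).
Context (F : X -> \bar Y) (kappa : W -> \bar Y).
Context (H : X -> \bar W) (G : X -> \bar Z).
Hypotheses (Sne : S !=set0) (Cne : C !=set0).
Hypotheses (Fproper : proper_map F) (kproper : proper_map kappa).
Hypothesis hA :
  feasible S C G `&` edom F `&` H @^-1` (EFin @` edom kappa) !=set0.
Implicit Types (L : X -> Y).

Lemma ecomp_nninfty (T V U : Type) (f : V -> \bar U) (g : T -> \bar V) x :
  (forall v, f v <> -oo%E) -> ecomp f g x <> -oo%E.
Proof. by rewrite /ecomp; case: (g x). Qed.

Lemma indic_map_proper (V : tvsType R) (D : set V) :
  D !=set0 -> proper_map (indic_map Y D).
Proof.
move=> [x Dx]; split=> [z|]; first by rewrite /indic_map; case: ifP.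
by exists x; rewrite /indic_map mem_set.
Qed.

Lemma scalarized_proper (T1 : W -> Y) (T2 : Z -> Y) :
  proper_map (scalarized H G T1 T2).
Proof.
rewrite /scalarized; split=> [x|].
  by rewrite /ecomp; case: (H x) => [?||]; case: (G x).
have [x [[[_ [_ [s _ <-] Gx]] _] [w _ Hx]]] := hA.
by exists x; rewrite /ecomp -Gx -Hx.
Qed.

Lemma objective_proper : proper_map (objective S C F kappa H G).
Proof.
have [Foo _] := Fproper; have [koo _] := kproper.
split=> [x|].
  rewrite /objective; have := Foo x.
  have := ecomp_nninfty (g := H) (x := x) koo.
  rewrite /indic_map.
  by case: (F x) => [?||] //; case: (ecomp _ _ _) => [?||] //; case: ifP.
have [x [[fx Fx] [w kw Hx]]] := hA; exists x.
rewrite /objective /indic_map mem_set// /ecomp -Hx.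
by move: Fx kw; rewrite /edom /=; case: (F x) => [?||] //; case: (kappa w).
Qed.

Lemma alpha_assertionP L y : alpha_assertion K S C F kappa H G L y <->
  ~ lower (dual_values (objective S C F kappa H G) L) y.
Proof.
have [Foo _] := Fproper; have [koo _] := kproper.
split=> [h [_ [x _ <-]]|h x Cx Gx [_ [k Ik <-]]].
  have := h x; have := Foo x; have := ecomp_nninfty (g := H) (x := x) koo.
  rewrite /objective /indic_map.
  (* An infeasible point contributes the value [-oo], which is above no [y]. *)
  have [fx|fx] := pselect (feasible S C G x); last first.
    rewrite memNset//.
    by case: (F x) => [?||] //; case: (ecomp _ _ _) => [?||].
  rewrite mem_set//; have [Cx Gx] := fx.
  case: (F x) => [f||] //; case: (ecomp _ _ _) => [e||] //= _ _ /(_ Cx Gx) nI.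
  move=> /ltK_fin yI; apply: nI; exists (f + e - L x + y) => //.
  exists (L x - (f + e + 0) - y) => //.
  by rewrite addr0 opprD opprB opprK.
have := Foo x; have := ecomp_nninfty (g := H) (x := x) koo.
case Fxe : (F x) => [f||] //; case Hxe : (ecomp _ _ _) => [e||] //= _ _ [kE].
apply: h; exists (L x - (f + e))%:E.
  exists x => //; rewrite /objective Fxe Hxe /indic_map mem_set //=.
  by rewrite /adde /= addr0.
apply/ltK_fin; have -> : L x - (f + e) - y = k; last by [].
by apply: oppr_inj; rewrite kE opprD opprK opprB.
Qed.

Lemma value_rearranged (V : zmodType) (f p e1 e2 m n y : V) :
  y - (p - f + (m - (e1 + e2)) + (n - 0)) = f - p + e1 + e2 - m - n + y.
Proof. by rewrite subr0 2!opprD !opprB addrC !addrA. Qed.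

(** Taking the three dual values exactly and lowering only [B] produces the form [B - int K] of the
    assertions; [B] stands for the set used in either of them. *)
Lemma assertion_lowerP L L' L'' (T1 : W -> Y) (T2 : Z -> Y) (B : set (\bar Y)) y :
  ~ B +oo%E ->
  (forall x x' x'', C x'' -> ~ esetD B (EFin @` (-%R @` I))
     (F x - (L' x)%:E + ecomp (EFin \o T1) H x' + ecomp (EFin \o T2) G x'
        - ((L - L' - L'') x')%:E - (L'' x'')%:E + y%:E)%E) <->
  ~ lower (esetD (esetD (esetD (dual_values F L')
      (dual_values (scalarized H G T1 T2) (L - L' - L'')))
      (dual_values (indic_map Y C) L'')) B) y.
Proof.
move=> Boo; have [Foo _] := Fproper.
rewrite lower_esetD_fin; last first.
  apply: esetD_npinfty; first apply: esetD_npinfty;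
    apply: dual_values_npinfty => //.
  - by case: (scalarized_proper T1 T2).
  - by case: (indic_map_proper Cne).
split=> [h [_ /esetD_finP[_ [c [/esetD_finP[a [b [
    /dual_values_finP[x [f [Fx ->]]] /dual_values_finP[x' [g [gx ->]]] ->]]]
    /dual_values_finP[x'' [d [dx ->]]] ->]]]
    [[v||] Bv //= /ltK_fin vI]]|h x x' x'' Cx'' [v Bv [_ [_ [k Ik <-] <-]]]].
  have [Cx'' d0] : C x'' /\ d = 0.
    move: dx; rewrite /indic_map; case: ifPn => //= /set_mem Cx [<-].
    by split.
  apply: (h x x' x'' Cx''); rewrite Fx; exists v%:E => //.
  move: gx; rewrite /scalarized.
  case: (ecomp _ H _) => [e1||] //; case: (ecomp _ G _) => [e2||] //= -[ge].
  (* [k] is the interior gap, so the expression of the assertion equals [v - k]. *)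
  pose k := v - (y - (L' x - f + ((L - L' - L'') x' - g) + (L'' x'' - d))).
  exists (- k)%:E; first by exists (- k) => //; exists k.
  by congr EFin; rewrite /k opprB addrC subrK -ge d0 value_rearranged.
move=> vE.
(* The right-hand side has no term [-oo] and the left-hand side is not [+oo], so all terms are
   finite. *)
have [f [e1 [e2 [w [Fx H1 G1 vw]]]]] : exists f e1 e2 w, [/\ F x = f%:E,
    ecomp (EFin \o T1) H x' = e1%:E,
    ecomp (EFin \o T2) G x' = e2%:E & v = w%:E].
  move: vE; have := Foo x; rewrite /ecomp.
  case: (F x) => [f||] //; case: (H x') => [e1||] //; case: (G x') => [e2||] //;
    case: v Bv => [w||] Bv //= _ _.
  by exists f, (T1 e1), (T2 e2), w.
move: vE; rewrite Fx H1 G1 vw => -[wE].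
apply: h; exists (L' x - f + ((L - L' - L'') x' - (e1 + e2)) + (L'' x'' - 0)).
  apply/esetD_finP.
  exists (L' x - f + ((L - L' - L'') x' - (e1 + e2))), (L'' x'' - 0).
  split=> //; last first.
    by apply/dual_values_finP; exists x'', 0; rewrite /indic_map mem_set.
  apply/esetD_finP.
  exists (L' x - f), ((L - L' - L'') x' - (e1 + e2)); split=> //.
    by apply/dual_values_finP; exists x, f.
  by apply/dual_values_finP; exists x', (e1 + e2); rewrite /scalarized H1 G1.
exists w%:E; first by rewrite -vw.
by apply/ltK_fin; rewrite value_rearranged -wE opprD opprK addrA subrr add0r.
Qed.

(** Both sets contain only pairs with [L] continuous linear, so no other [L] has to be compared. *)
Lemma eq_setP (A B : set ((X -> Y) * Y)) (a b : (X -> Y) -> Y -> Prop) :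
  (forall L y, A (L, y) <-> contlin X Y L /\ a L y) ->
  (forall L y, B (L, y) <-> contlin X Y L /\ b L y) ->
  A = B <-> forall L y, contlin X Y L -> (a L y <-> b L y).
Proof.
move=> Aa Bb; split=> [AB L y cL|ab].
  by split=> h; [have /Bb[] : B (L, y) by rewrite -AB; apply/Aa
                |have /Aa[] : A (L, y) by rewrite AB; apply/Bb].
apply/seteqP; split=> -[L y] => [/Aa[cL]|/Bb[cL]] /(ab L y cL) h.
  exact/Bb.
exact/Aa.
Qed.

Lemma epi_objectiveP L y : epi_conj K (objective S C F kappa H G) (L, y) <->
  contlin X Y L /\ alpha_assertion K S C F kappa H G L y.
Proof. by rewrite alpha_assertionP epi_conjP//; exact: objective_proper. Qed.

(** [Q] comes from the union of epigraphs and [B] from the assertion; only their lower sets matter.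
    [L'] and [L''] are the first and third maps of the decomposition of [L]. *)
Lemma Psi_assertionP L (T1 : W -> Y) (T2 : Z -> Y) (Q B : set (\bar Y)) y :
  ~ B +oo%E -> lower Q !=set0 -> lower Q = lower B ->
  Psi (boxplus K (boxplus K (boxplus K (Epi_conj K F)
         (Epi_conj K (scalarized H G T1 T2)))
         (Epi_conj K (indic_map Y C))) [set (0, Q)]) (L, y) <->
  contlin X Y L /\ exists L' L'', [/\ contlin X Y L', contlin X Y L'' &
    forall x x' x'', C x'' -> ~ esetD B (EFin @` (-%R @` I))
     (F x - (L' x)%:E + ecomp (EFin \o T1) H x' + ecomp (EFin \o T2) G x'
        - ((L - L' - L'') x')%:E - (L'' x'')%:E + y%:E)%E].
Proof.
move=> Boo Q0 QB; rewrite Psi_boxplusP//; last 2 first.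
- exact: scalarized_proper.
- exact: indic_map_proper.
split=> [[L1 [L2 [L3 [c1 c2 c3 -> nQ]]]]|
    [cL [L' [L'' [c' c'' /assertion_lowerP nB]]]]].
  split; first by do 2! apply: contlinD => //.
  exists L1, L3; split=> //; apply/assertion_lowerP => //.
  have -> : L1 + L2 + L3 - L1 - L3 = L2 by rewrite addrAC [L1 + L2]addrC !addrK.
  by rewrite (eq_lower_esetD (erefl _) (esym QB)).
exists L', (L - L' - L''), L''; split=> //.
- by do 2! apply: contlinB => //.
- by rewrite [L' + _]addrC addrAC !subrK.
- by rewrite (eq_lower_esetD (erefl _) QB); exact: nB.
Qed.

Lemma lower_conjugate_indic (V : tvsType R) (D : set V) (T : V -> Y) :
  lower (conjugate K (indic_map Y D) T) = lower (EFin @` (T @` D)).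
Proof.
have sub0 z : ((T z)%:E - 0%:E)%E = (T z)%:E by exact: (congr1 EFin (subr0 _)).
rewrite lower_WSup; apply/seteqP; split=> w [u].
  move=> [z _ <-]; rewrite /indic_map; case: ifPn => // /set_mem Dz.
  rewrite sub0 => wz.
  by exists (T z)%:E => //; exists (T z) => //; exists z.
move=> [_ [z Dz <-] <-] wz; exists (T z)%:E => //.
by exists z => //; rewrite /indic_map mem_set.
Qed.

(** An element [+oo] would put every point in the lower set. *)
Lemma dom_conj_npinfty (T1 : W -> Y) :
  dom_conj K kappa T1 -> ~ conjugate K kappa T1 +oo%E.
Proof.
move=> /dom_conj_lower[_ lT] koo; apply: lT; rewrite -lower_WSup.
by apply/seteqP; split=> // w _; exists +oo%E.
Qed.

Lemma lower_conjugate_neq0 (V : tvsType R) (E : V -> \bar Y) (T : V -> Y) :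
  proper_map E -> lower (conjugate K E T) !=set0.
Proof. by move=> Ep; rewrite lower_WSup; exact: lower_dual_values_neq0. Qed.

(** The last summand is a [WSup] in [M3] and a plain sum with the image of [-S] under [T2] in the
    assertion; [WSup] does not change lower sets. *)
Lemma M3P L y : M3 K S C F kappa H G (L, y) <->
  contlin X Y L /\ zeta_assertion K S C F kappa H G L y.
Proof.
have NSne : (-%R @` S) !=set0 by have [s Ss] := Sne; exists (- s); exists s.
have PsiP (T1 : W -> Y) (T2 : Z -> Y) (h1 : dom_conj K kappa T1) :
    let Q := uplus K (conjugate K kappa T1)
      (conjugate K (indic_map Y (-%R @` S)) T2) in
    let B := esetD (conjugate K kappa T1) (EFin @` (T2 @` (-%R @` S))) in
    [/\ ~ B +oo%E, lower Q !=set0 & lower Q = lower B].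
  move=> Q B; have QB : lower Q = lower B.
    rewrite lower_WSup; apply: eq_lower_esetD => //.
    exact: lower_conjugate_indic.
  split=> //; first by apply: esetD_npinfty => [|[]//]; exact: dom_conj_npinfty.
  rewrite lower_WSup; apply: lower_esetD_neq0; apply: lower_conjugate_neq0 => //.
  exact: indic_map_proper.
split=> [[T1 h1 [T2 h2]]|[cL [L' [L'' [T1 [T2 [c' c'' h1 h2 h]]]]]]].
  have [Boo Q0 QB] := PsiP T1 T2 h1.
  move=> /(Psi_assertionP _ _ _ _ Boo Q0 QB)[cL [L' [L'' [c' c'' h]]]].
  by split=> //; exists L', L'', T1, T2.
exists T1 => //; exists T2 => //; have [Boo Q0 QB] := PsiP T1 T2 h1.
by apply/(Psi_assertionP _ _ _ _ Boo Q0 QB); split=> //; exists L', L''.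
Qed.

(** The conjugate of [kappa] at [T1] serves as both [Q] and [B]. *)
Lemma M3plusP L y : M3plus K P S C F kappa H G (L, y) <->
  contlin X Y L /\ eta_assertion K P S C F kappa H G L y.
Proof.
split=> [[T1 h1 [T2 h2]]|[cL [L' [L'' [T1 [T2 [c' c'' h1 h2 h]]]]]]].
  move=> /(Psi_assertionP _ _ _ _ (dom_conj_npinfty h1.1)
    (lower_conjugate_neq0 _ kproper) (erefl _))[cL [L' [L'' [c' c'' h]]]].
  by split=> //; exists L', L'', T1, T2.
exists T1 => //; exists T2 => //.
apply/(Psi_assertionP _ _ _ _ (dom_conj_npinfty h1.1)
  (lower_conjugate_neq0 _ kproper) (erefl _)).
by split=> //; exists L', L''.
Qed.

End composite.
End ordering.

(** * Equalities of sets as equivalences of assertions *)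

Theorem corollary5p9 (R : realType) (X Y Z W : tvsType R)
  (hX : hausdorff_space X) (hY : hausdorff_space Y)
  (hZ : hausdorff_space Z) (hW : hausdorff_space W)
  (K : set Y) (Kcone : convex_cone K) (Kclosed : closed K)
  (Kproper : K <> setT) (Kint : interior K !=set0)
  (P : set W) (Pcone : convex_cone P) (Pne : P !=set0)
  (S : set Z) (Scone : convex_cone S) (Sne : S !=set0)
  (F : X -> \bar Y) (kappa : W -> \bar Y)
  (H : X -> \bar W) (G : X -> \bar Z)
  (Fproper : proper_map F) (kproper : proper_map kappa)
  (Hproper : proper_map H) (Gproper : proper_map G)
  (C : set X) (Cne : C !=set0)
  (hA : feasible S C G `&` edom F `&` H @^-1` (EFin @` edom kappa) !=set0) :
  (epi_conj K (objective S C F kappa H G) = M3 K S C F kappa H G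
   <-> (forall (L : X -> Y) (y : Y), contlin X Y L ->
          (alpha_assertion K S C F kappa H G L y
           <-> zeta_assertion K S C F kappa H G L y)))
  /\
  (epi_conj K (objective S C F kappa H G) = M3plus K P S C F kappa H G
   <-> (forall (L : X -> Y) (y : Y), contlin X Y L ->
          (alpha_assertion K S C F kappa H G L y
           <-> eta_assertion K P S C F kappa H G L y))).
Proof.
by split; apply: eq_setP => L y;
  first [exact: epi_objectiveP|exact: M3P|exact: M3plusP].
Qed.
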